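(* Let $F:\mathbb{R}^n\to\mathbb{R}^n$, let $x_{k-1},x_k\in\mathbb{R}^n$, and set $p_{k-1}=x_k-x_{k-1}$, $y_{k-1}=F(x_k)-F(x_{k-1})$. Assume that $p_{k-1}=\beta_{k-1}F(x_{k-1})$ or $p_{k-1}=-\beta_{k-1}F(x_{k-1})$ for some nonzero scalar $\beta_{k-1}\in\mathbb{R}$, and that $F$ is continuously differentiable in an open convex set $D\subset\mathbb{R}^n$ containing $x_{k-1}+t\,p_{k-1}$ for all $t\in[0,1]$. Assume that the scalars $$\beta_{k,1}=\frac{p_{k-1}^Tp_{k-1}}{p_{k-1}^Ty_{k-1}},\qquad \beta_{k,2}=\frac{p_{k-1}^Ty_{k-1}}{y_{k-1}^Ty_{k-1}}$$ are well defined and nonzero. Then: (P1) $\beta_{k,1}$ and $\beta_{k,2}$ have the same sign and $|\beta_{k,2}|\le|\beta_{k,1}|$; (P2) either $\beta_{k,1}\le\beta_{k,2}<0$ or $0<\beta_{k,2}\le\beta_{k,1}$; (P3) with $F_{k-1}=F(x_{k-1})$, $$\beta_{k,1}=\frac{1}{q\big((G_S)_{k-1},p_{k-1}\big)}=\frac{1}{q\big((G_S)_{k-1},F_{k-1}\big)}$$ and $$\beta_{k,2}=\frac{q\big((G_S)_{k-1},p_{k-1}\big)}{q\big(G_{k-1}^TG_{k-1},p_{k-1}\big)}=\frac{q\big((G_S)_{k-1},F_{k-1}\big)}{q\big(G_{k-1}^TG_{k-1},F_{k-1}\big)}.$$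
   Context: $J$ denotes the Jacobian matrix of $F$, and for a square matrix $A$, $A_S=\frac12(A+A^T)$ denotes its symmetric part (so $J_S$ is the symmetric part of $J$). The average matrices are $$G_{k-1}=\int_0^1 J(x_{k-1}+t\,p_{k-1})\,dt,\qquad (G_S)_{k-1}=\int_0^1 J_S(x_{k-1}+t\,p_{k-1})\,dt.$$ For a symmetric matrix $M$ and a nonzero vector $p$, $q(M,p)=\dfrac{p^TMp}{p^Tp}$ is the Rayleigh quotient. *)

(* Defs.v *)
From HB Require Import structures.
From mathcomp Require Import all_boot all_order all_algebra.
From mathcomp Require Import all_classical all_reals all_analysis.

Set Implicit Arguments.
Unset Strict Implicit.
Unset Printing Implicit Defensive.

Import Order.TTheory GRing.Theory Num.Theory.
Import numFieldNormedType.Exports.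

Local Open Scope classical_set_scope.
Local Open Scope ring_scope.

(* Points of R^n are row vectors, so u^T v is the entry of u *m v^T and
   p^T M p is the entry of p *m M *m p^T. *)
Definition dot (R : realType) (n : nat) (u v : 'rV[R]_n) : R :=
  (u *m v^T) 0 0.

Definition rayleigh (R : realType) (n : nat) (M : 'M[R]_n) (p : 'rV[R]_n) : R :=
  (p *m M *m p^T) 0 0 / dot p p.

(* [jacobian F x] acts on row vectors from the right, 'd F x v = v *m 'J F x;
   the usual Jacobian matrix, with (i, j) entry dF_i/dx_j, is its transpose. *)
Definition jac (R : realType) (n : nat) (F : 'rV[R]_n -> 'rV[R]_n)
    (x : 'rV[R]_n) : 'M[R]_n :=
  (jacobian F x)^T.

Definition symm_part (R : realType) (n : nat) (A : 'M[R]_n) : 'M[R]_n :=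
  2^-1 *: (A + A^T).

Definition C1_on (R : realType) (n : nat) (D : set 'rV[R]_n)
    (F : 'rV[R]_n -> 'rV[R]_n) : Prop :=
  (forall x, D x -> differentiable F x) /\ {within D, continuous (jac F)}.

(* Integral over the segment from x to x + p, entry by entry. *)
Definition avg_mx (R : realType) (n : nat) (A : 'rV[R]_n -> 'M[R]_n)
    (x p : 'rV[R]_n) : 'M[R]_n :=
  \matrix_(i < n, j < n)
    \int[lebesgue_measure]_(t in `[0%R, 1%R]) (A (x + t *: p) i j).

Definition avg_jac (R : realType) (n : nat) (F : 'rV[R]_n -> 'rV[R]_n)
    (x p : 'rV[R]_n) : 'M[R]_n :=
  avg_mx (jac F) x p.

Definition avg_jacS (R : realType) (n : nat) (F : 'rV[R]_n -> 'rV[R]_n)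
    (x p : 'rV[R]_n) : 'M[R]_n :=
  avg_mx (fun z => symm_part (jac F z)) x p.

Definition beta1 (R : realType) (n : nat) (p y : 'rV[R]_n) : R :=
  dot p p / dot p y.

Definition beta2 (R : realType) (n : nat) (p y : 'rV[R]_n) : R :=
  dot p y / dot y y.

(* Main.v *)
Require Import Defs.
From HB Require Import structures.
From mathcomp Require Import all_boot all_order all_algebra.
From mathcomp Require Import all_classical all_reals all_analysis.
From mathcomp Require Import ring.

(** The two step lengths are quotients of the three numbers [dot p p],
[dot p y], [dot y y], of which the outer ones are positive.  Both step lengths
therefore carry the sign of [dot p y], and the comparison of their absolute
values is exactly the Cauchy-Schwarz inequality
[dot p y ^+ 2 <= dot p p * dot y y]; the second claim is a case split on that
common sign.

The Rayleigh quotient formulas rest on the mean value identity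
[y = G p] with [G] the average Jacobian ([mean_value_jac]), which is the
fundamental theorem of calculus applied to each coordinate of
[t |-> F (x0 + t p)].  It gives [dot p y = p^T G p] and
[dot y y = p^T (G^T G) p].  A quadratic form only sees the symmetric part of
its matrix ([rayleigh_symm_part]), and averaging commutes with taking symmetric
parts ([avg_jacS_symm_part]), so [G] may be replaced with the average of the
symmetrised Jacobian in the first form.  Finally [p] is a nonzero multiple of
[F x0] and Rayleigh quotients are invariant under rescaling ([rayleighZ]), so
each quotient may be evaluated at [F x0] as well. *)

Import Order.TTheory GRing.Theory Num.Theory.
Import numFieldNormedType.Exports.

Local Open Scope classical_set_scope.
Local Open Scope ring_scope.


(** * Dot product *)

Section DotProduct.
Variables (R : realType) (n : nat).
Implicit Types u v w : 'rV[R]_n.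

Lemma dotE u v : dot u v = \sum_i u 0 i * v 0 i.
Proof. by rewrite /dot mxE; apply: eq_bigr => i _; rewrite mxE. Qed.

Lemma dotC u v : dot u v = dot v u.
Proof. by rewrite !dotE; apply: eq_bigr => i _; rewrite mulrC. Qed.

Lemma dotBr u v w : dot u (v - w) = dot u v - dot u w.
Proof. by rewrite /dot linearB mulmxBr !mxE. Qed.

Lemma dotZr a u v : dot u (a *: v) = a * dot u v.
Proof. by rewrite /dot linearZ -scalemxAr mxE. Qed.

Lemma dotBl u v w : dot (u - v) w = dot u w - dot v w.
Proof. by rewrite dotC dotBr !(dotC w). Qed.

Lemma dotZl a u v : dot (a *: u) v = a * dot u v.
Proof. by rewrite dotC dotZr dotC. Qed.

Lemma dot_ge0 u : 0 <= dot u u.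
Proof. by rewrite dotE; apply: sumr_ge0 => i _; rewrite -expr2 sqr_ge0. Qed.

Lemma dot0l v : dot 0 v = 0.
Proof. by rewrite /dot mul0mx mxE. Qed.

Lemma dot_definite u : dot u u = 0 -> u = 0.
Proof.
rewrite dotE => /psumr_eq0P uu0; apply/rowP => i; rewrite mxE.
by apply/eqP; rewrite -sqrf_eq0 expr2 uu0// => j _; rewrite -expr2 sqr_ge0.
Qed.

Lemma dot_gt0 u : u != 0 -> 0 < dot u u.
Proof.
move=> u_neq0; rewrite lt_neqAle dot_ge0 andbT eq_sym.
by apply: contra_neq u_neq0; exact: dot_definite.
Qed.

(** The nonnegative number [dot w w], for [w] the component of [u] orthogonal to
[v] rescaled by [dot v v] to clear the denominator, is [dot v v] times the
defect of the inequality. *)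
Lemma dot_cauchy_schwarz u v : dot u v ^+ 2 <= dot u u * dot v v.
Proof.
have [->|/dot_gt0 vv_gt0] := eqVneq v 0.
  by rewrite dotC !dot0l expr0n/= mulr0.
pose w := dot v v *: u - dot u v *: v.
have ww : dot w w = dot v v * (dot u u * dot v v - dot u v ^+ 2).
  rewrite /w dotBr !dotBl !dotZr !dotZl (dotC v u).
  by ring.
by have := dot_ge0 w; rewrite ww pmulr_rge0// subr_ge0.
Qed.

End DotProduct.

(** * Rayleigh quotients *)

Section Rayleigh.
Variables (R : realType) (n : nat).
Implicit Types (A : 'M[R]_n) (u : 'rV[R]_n).

Lemma symm_partE A i j : symm_part A i j = 2^-1 * (A i j + A j i).
Proof. by rewrite !mxE. Qed.

(** A scalar equals its transpose, so [u^T A u] and [u^T A^T u] coincide and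
only the symmetric part of [A] contributes to the quadratic form.  The product
[A u] is written [u *m A^T], vectors being rows. *)
Lemma rayleigh_symm_part A u : rayleigh (symm_part A) u = dot u (u *m A^T) / dot u u.
Proof.
rewrite /rayleigh /symm_part; congr (_ / _).
have trE : (u *m A^T *m u^T) 0 0 = (u *m A *m u^T) 0 0.
  by rewrite -[in RHS](trmxK (u *m A *m u^T)) [in RHS]mxE !trmx_mul trmxK mulmxA.
rewrite -scalemxAr -scalemxAl mxE mulmxDr mulmxDl mxE trE.
rewrite /dot trmx_mul trmxK mulmxA.
by field.
Qed.

Lemma rayleigh_gram A u : rayleigh (A^T *m A) u = dot (u *m A^T) (u *m A^T) / dot u u.
Proof. by rewrite /rayleigh /dot trmx_mul trmxK !mulmxA. Qed.

Lemma rayleighZ A u a : a != 0 -> rayleigh A (a *: u) = rayleigh A u.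
Proof.
move=> a_neq0; rewrite /rayleigh /dot linearZ -!scalemxAl -!scalemxAr !mxE.
by rewrite -!mulf_div divff// !mul1r.
Qed.

End Rayleigh.

(** * Averages of the Jacobian along a segment *)

Lemma Rintegral_sum d (T : measurableType d) (R : realType)
    (nu : {measure set T -> \bar R}) (A : set T) (n : nat) (f : 'I_n -> T -> R) :
  measurable A -> (forall i, nu.-integrable A (EFin \o f i)) ->
  \int[nu]_(t in A) (\sum_i f i t) = \sum_i \int[nu]_(t in A) f i t.
Proof.
move=> mA fi; rewrite /Rintegral.
under eq_integral do rewrite -sumEFin.
rewrite integral_sum// -sum_fine// => i _.
by apply: integrable_fin_num => //; exact: fi.
Qed.

Section AverageMatrix.
Variables (R : realType) (n : nat).
Variables (F : 'rV[R]_n -> 'rV[R]_n) (D : set 'rV[R]_n) (x p : 'rV[R]_n).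
Hypotheses (Dopen : open D) (FC1 : C1_on D F).
Hypothesis Dseg : forall t : R, 0 <= t <= 1 -> D (x + t *: p).
Let mu := @lebesgue_measure R.

(** Since [D] is open, continuity within [D] is continuity at its points, so
it survives precomposition with the line, even at the two endpoints where the
line may leave the segment. *)
Lemma jac_entry_continuous i j t : 0 <= t <= 1 ->
  {for t, continuous (fun s : R => jac F (x + s *: p) i j)}.
Proof.
move=> /Dseg Dt; have [_] := FC1.
rewrite continuous_open_subspace// => /(_ _ (mem_set Dt)) cJ.
have cl : {for t, continuous (fun s : R => x + s *: p)}.
  by apply: cvgD; [exact: cvg_cst|exact: scalel_continuous].
apply: (@continuous_comp _ _ _ (fun s : R => x + s *: p) (fun z => jac F z i j)) => //.
apply: (@continuous_comp _ _ _ (jac F) (fun M : 'M[R]_n => M i j)) => //.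
exact: coord_continuous.
Qed.

Lemma jac_entry_integrable i j :
  mu.-integrable `[0%R, 1%R] (EFin \o (fun s : R => jac F (x + s *: p) i j)).
Proof.
apply: continuous_compact_integrable; first exact: segment_compact.
apply: continuous_in_subspaceT => t.
by rewrite inE/= in_itv/=; exact: jac_entry_continuous.
Qed.

(** The chain rule, read coordinatewise: the velocity of [s |-> x + s p] is [p],
so the derivative is the Jacobian applied to [p]. *)
Lemma derive_along_segment i (t : R) : 0 <= t <= 1 ->
  is_derive t 1 (fun s : R => F (x + s *: p) 0 i)
                (\sum_j jac F (x + t *: p) i j * p 0 j).
Proof.
move=> /Dseg Dt; have [/(_ _ Dt) dF _] := FC1.
have ds : is_derive t 1 ( *:%R^~ p : R -> 'rV[R]_n) p.
  apply: DeriveDef; first exact/derivable1_diffP.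
  by rewrite deriveE// diff_val scale1r.
have dl : is_derive t 1 (fun s : R => x + s *: p) p.
  rewrite (_ : (fun s : R => x + s *: p) = cst x + ( *:%R^~ p)); last exact/funext.
  by rewrite -[p in is_derive _ _ _ p]add0r; apply: is_deriveD.
have diffl : differentiable (fun s : R => x + s *: p) t.
  by apply/derivable1_diffP; exact: ex_derive.
have diffh : differentiable (F \o (fun s : R => x + s *: p)) t.
  exact: differentiable_comp.
have dlE : 'd (fun s : R => x + s *: p) t 1 = p by rewrite -deriveE// derive_val.
have /derivable1_diffP h1 := diffh.
have hE : 'D_1 (F \o (fun s : R => x + s *: p)) t = p *m jacobian F (x + t *: p).
  by rewrite deriveE// diff_comp//= dlE -deriveE// deriveEjacobian.
apply: DeriveDef; first by have /derivable_mxP := h1; exact.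
move: hE; rewrite derive_mx// => /rowP /(_ i); rewrite !mxE => ->.
by apply: eq_bigr => j _; rewrite mulrC !mxE.
Qed.

(** Linearity of the integral makes the [i]-th entry on the left the integral
over the unit interval of the derivative of [s |-> F_i (x + s p)], to which the
fundamental theorem of calculus applies.  In general no single point would
do for all coordinates, hence the averaging. *)
Lemma mean_value_jac : p *m (avg_jac F x p)^T = F (x + p) - F x.
Proof.
apply/rowP => i; rewrite !mxE.
transitivity (\sum_j \int[mu]_(t in `[0%R, 1%R]) (jac F (x + t *: p) i j * p 0 j)).
  apply: eq_bigr => j _; rewrite !mxE mulrC RintegralZr//.
  exact: jac_entry_integrable.
rewrite -Rintegral_sum//; last first.
  move=> j; have := jac_entry_integrable i j.
  move=> /(integrableZr _ (p 0 j)) => /(_ (measurable_itv _)).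
  by apply: eq_integrable => // t _; rewrite /= EFinM.
rewrite /Rintegral (@continuous_FTC2 _ _ (fun s : R => F (x + s *: p) 0 i))//.
- by rewrite /= scale1r scale0r addr0.
- apply: continuous_in_subspaceT => t; rewrite inE/= in_itv/= => t01.
  apply: cvg_big => [|j _]; first exact: add_continuous.
  by apply: cvgMr_tmp; exact: jac_entry_continuous.
- have cF t : 0 <= t <= 1 -> {for t, continuous (fun s : R => F (x + s *: p) 0 i)}.
    move=> /(derive_along_segment i) dF; apply: differentiable_continuous.
    by apply/derivable1_diffP; exact: ex_derive.
  split.
  + move=> t; rewrite in_itv/= => /andP[/ltW t0 /ltW t1].
    have t01 : 0 <= t <= 1 by rewrite t0.
    by have := derive_along_segment i t t01.
  + by apply: cvg_at_right_filter; apply: cF; rewrite lexx ler01.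
  + by apply: cvg_at_left_filter; apply: cF; rewrite lexx ler01.
- move=> t; rewrite in_itv/= => /andP[/ltW t0 /ltW t1].
  rewrite derive1E; apply: derive_val.
  by apply: derive_along_segment; rewrite t0.
Qed.

Lemma avg_jacS_symm_part : avg_jacS F x p = symm_part (avg_jac F x p).
Proof.
apply/matrixP => i j; rewrite symm_partE !mxE.
under eq_Rintegral do rewrite symm_partE.
rewrite RintegralZl//; first by rewrite RintegralD//; exact: jac_entry_integrable.
apply: (eq_integrable _ _ _ _ (integrableD _ (jac_entry_integrable i j)
  (jac_entry_integrable j i))) => //.
Qed.

End AverageMatrix.

(** * Signs and sizes of the two step lengths *)

Section StepLengths.
Variables (R : realType) (n : nat) (p y : 'rV[R]_n).
Hypotheses (py_neq0 : dot p y != 0) (yy_neq0 : dot y y != 0).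

Let pp_gt0 : 0 < dot p p.
Proof. by apply: dot_gt0; apply: contra_neq py_neq0 => ->; rewrite dot0l. Qed.

Let yy_gt0 : 0 < dot y y.
Proof. by rewrite lt_neqAle eq_sym yy_neq0 dot_ge0. Qed.

Lemma beta1_sg : Num.sg (beta1 p y) = Num.sg (dot p y).
Proof. by rewrite /beta1 sgrM sgrV gtr0_sg// mul1r. Qed.

Lemma beta2_sg : Num.sg (beta2 p y) = Num.sg (dot p y).
Proof. by rewrite /beta2 sgrM sgrV (gtr0_sg yy_gt0) mulr1. Qed.

(** Clearing the positive denominators turns this into the Cauchy-Schwarz
inequality for [p] and [y]. *)
Lemma beta_norm_le : `|beta2 p y| <= `|beta1 p y|.
Proof.
rewrite /beta1 /beta2 !normf_div (gtr0_norm pp_gt0) (gtr0_norm yy_gt0).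
rewrite ler_pdivrMr// mulrAC ler_pdivlMr ?normr_gt0//.
by rewrite -expr2 real_normK ?num_real// dot_cauchy_schwarz.
Qed.

End StepLengths.

Theorem lemma3p3 (R : realType) (n : nat) (F : 'rV[R]_n -> 'rV[R]_n)
    (x0 x1 p y : 'rV[R]_n) (b : R) (D : set 'rV[R]_n)
    (hp : p = x1 - x0)
    (hy : y = F x1 - F x0)
    (hb : b != 0)
    (hpF : p = b *: F x0 \/ p = - b *: F x0)
    (Dopen : open D)
    (Dconvex : convex_set (D : set (convex_lmodType 'rV[R]_n)))
    (Dseg : forall t : R, 0 <= t <= 1 -> D (x0 + t *: p))
    (FC1 : C1_on D F)
    (py_neq0 : dot p y != 0)
    (yy_neq0 : dot y y != 0)
    (beta1_neq0 : beta1 p y != 0)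
    (beta2_neq0 : beta2 p y != 0) :
  (Num.sg (beta1 p y) = Num.sg (beta2 p y) /\
     `|beta2 p y| <= `|beta1 p y|) /\
  ((beta1 p y <= beta2 p y /\ beta2 p y < 0) \/
   (0 < beta2 p y /\ beta2 p y <= beta1 p y)) /\
  let G := avg_jac F x0 p in
  let GS := avg_jacS F x0 p in
  (beta1 p y = 1 / rayleigh GS p /\
   beta1 p y = 1 / rayleigh GS (F x0) /\
   beta2 p y = rayleigh GS p / rayleigh (G^T *m G) p /\
   beta2 p y = rayleigh GS (F x0) / rayleigh (G^T *m G) (F x0)).
Proof.
have sgE : Num.sg (beta1 p y) = Num.sg (beta2 p y).
  by rewrite beta1_sg// beta2_sg.
have leE := beta_norm_le _ _ p y py_neq0 yy_neq0.
have pp_neq0 : dot p p != 0.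
  by move: beta1_neq0; rewrite /beta1 mulf_eq0 negb_or => /andP[].
have yG : y = p *m (avg_jac F x0 p)^T.
  by rewrite (mean_value_jac _ _ _ _ _ _ Dopen FC1 Dseg) hy hp addrCA subrr addr0.
have [c c_neq0 pE] : exists2 c, c != 0 & p = c *: F x0.
  by case: hpF => ->; [exists b|exists (- b); rewrite ?oppr_eq0].
split=> //; split.
  move: beta2_neq0; rewrite neq_lt => /orP[b2_lt0|b2_gt0].
    left; split=> //; rewrite -lerN2.
    have b1_lt0 : beta1 p y < 0 by rewrite -sgr_cp0 sgE sgr_cp0.
    by move: leE; rewrite !ltr0_norm.
  right; split=> //.
  have b1_gt0 : 0 < beta1 p y by rewrite -sgr_cp0 sgE sgr_cp0.
  by move: leE; rewrite !gtr0_norm.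
move=> G GS.
have rGS : rayleigh GS p = dot p y / dot p p.
  by rewrite /GS (avg_jacS_symm_part _ _ _ _ _ _ Dopen FC1 Dseg) rayleigh_symm_part -yG.
have rGG : rayleigh (G^T *m G) p = dot y y / dot p p.
  by rewrite rayleigh_gram -yG.
have rF (M : 'M[R]_n) : rayleigh M (F x0) = rayleigh M p by rewrite pE rayleighZ.
rewrite !rF rGS rGG /beta1 /beta2.
have -> : dot p p / dot p y = 1 / (dot p y / dot p p) by field; rewrite pp_neq0.
have -> : dot p y / dot y y = (dot p y / dot p p) / (dot y y / dot p p).
  by field; rewrite pp_neq0.
by [].
Qed.
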